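(* Let $d\ge0$ and $q\geq1$ be integers, let $U=\{v\}\cup N(v)$ be the vertex set of a star with center $v$ and set of leaves $N(v)=\{1,\dots,d\}$, and let $\nu$ be a probability distribution on $[q]^U$ such that for $X\sim\nu$ the leaf spins $(X_i)_{i\in N(v)}$ are independent conditionally on $X_v$. Suppose that $$r:=\|(P_v)_{00}\|<\frac15\qquad\text{and}\qquad\eta:=\frac{\|(P_v)_{10}\|^2}{(1-r)(1-4r)}<1.$$ Then for every $f\in L^2(\nu)$ with $\mathbb E_\nu f=0$, $$\frac{1-\eta}{2}\langle f,f\rangle_\nu\leq\left\langle f,\left(\mathcal L_v+\frac{1+\eta}{2}\mathcal L_{N(v)}\right)f\right\rangle_\nu.$$
   Context: $L^2(\nu)$ is the space of real functions on the support of $\nu$ with $\langle f,g\rangle_\nu=\sum_x\nu(x)f(x)g(x)$. For $u\in U$, $(P_uf)(x)=\mathbb E_\nu[f(X)\mid X_{U\setminus\{u\}}=x_{U\setminus\{u\}}]$ is the heat-bath projection, $\mathcal L_u=\mathrm{Id}-P_u$, and $\mathcal L_{N(v)}=\sum_{i=1}^d\mathcal L_i$. All operators act on $\mathbf 1^\perp=\{f\in L^2(\nu):\mathbb E_\nu f=0\}$. On $\mathbf 1^\perp$ the operator $\mathcal L_{N(v)}$ is self-adjoint with eigenvalues in $\{0,1,\dots,d\}$; set $K_0=\ker(\mathcal L_{N(v)})$, $K_1=\ker(\mathcal L_{N(v)}-\mathrm{Id})$, and $K_2=\bigoplus_{k=2}^d\ker(\mathcal L_{N(v)}-k\,\mathrm{Id})$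 (all as subspaces of $\mathbf 1^\perp$; $K_2=0$ if $d<2$), so that $\mathbf 1^\perp=K_0\oplus K_1\oplus K_2$ orthogonally. For a linear map $T:\mathbf 1^\perp\to\mathbf 1^\perp$, its block is $T_{ij}=\mathrm{proj}_{K_i}T|_{K_j}:K_j\to K_i$, where $\mathrm{proj}_{K_i}$ is the orthogonal projection. $\|\cdot\|$ is the operator norm with respect to the norm of $L^2(\nu)$ (and is $0$ if the domain or the codomain is the zero space). *)

(* Defs.v *)
From HB Require Import structures.
From mathcomp Require Import all_boot all_order all_algebra.
From mathcomp Require Import boolp classical_sets reals.

Set Implicit Arguments.
Unset Strict Implicit.
Unset Printing Implicit Defensive.

Import Order.TTheory GRing.Theory Num.Theory.
Local Open Scope ring_scope.

(* The vertex set of the star is [option 'I_d]: [None] is the center v and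
   [Some i] is the i-th leaf.  The spin set [q] is ['I_q]. *)
Definition config (d q : nat) : finType := {ffun option 'I_d -> 'I_q}.

Section Star.
Variables (R : realType) (d q : nat) (nu : config d q -> R).

Definition is_distr : Prop := (forall x, 0 <= nu x) /\ \sum_x nu x = 1.

Definition Pr (A : {set config d q}) : R := \sum_(x in A) nu x.

Definition condPr (A B : {set config d q}) : R := Pr (A :&: B) / Pr B.

(* Taking [S i = setT] for some of the leaves gives the product rule for all
   subfamilies of the leaf spins. *)
Definition leaves_cond_indep : Prop :=
  forall (a : 'I_q) (S : 'I_d -> {set 'I_q}),
    let C : {set config d q} := [set x : config d q | x None == a] in
    Pr C != 0 ->
    condPr [set x : config d q | [forall i, x (Some i) \in S i]] C
    = \prod_(i < d) condPr [set x : config d q | x (Some i) \in S i] C.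

Definition supp : finType := {x : config d q | nu x != 0}.

Definition L2 : vectType R := {ffun supp -> R^o}.

Definition inner (f g : L2) : R := \sum_x nu (val x) * f x * g x.

Lemma inner_bilinear : bilinear_for *%R *%R inner.
Proof.
split=> [g a f1 f2|f a g1 g2] /=; rewrite /inner mulr_sumr -big_split /=;
  apply: eq_bigr => x _; rewrite !ffunE /GRing.scale /=.
  by rewrite mulrDr mulrDl mulrCA -!mulrA.
by rewrite mulrDr [_ * (a * _)]mulrCA.
Qed.

Lemma inner_sym (f g : L2) : inner f g = (-1) ^+ false * idfun (inner g f).
Proof. by rewrite expr0 mul1r; apply: eq_bigr => x _; rewrite mulrAC. Qed.

HB.instance Definition _ :=
  bilinear_isBilinear.Build R L2 L2 R *%R *%R inner inner_bilinear.
HB.instance Definition _ :=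
  isHermitianSesquilinear.Build R L2 false idfun inner inner_sym.

Definition L2norm (f : L2) : R := Num.sqrt (inner f f).

Definition mean (f : L2) : R^o := \sum_x nu (val x) * f x.

Lemma mean_linear : linear mean.
Proof.
move=> a f g; rewrite /mean scaler_sumr -big_split /=; apply: eq_bigr => x _.
by rewrite !ffunE mulrDr; congr (_ + _); rewrite /GRing.scale /= mulrCA.
Qed.
HB.instance Definition _ :=
  GRing.isSemilinear.Build R L2 R^o _ mean (GRing.semilinear_linear mean_linear).

Definition one_perp : {vspace L2} := lker (linfun mean).

Definition cond_mean (f : L2) (A : pred (config d q)) : R :=
  (\sum_(x : supp | A (val x)) nu (val x) * f x)
    / \sum_(x : supp | A (val x)) nu (val x).

Definition agree_off (u : option 'I_d) (x y : config d q) : bool :=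
  [forall w, (w != u) ==> (y w == x w)].

Definition heat_bath_fun (u : option 'I_d) (f : L2) : L2 :=
  [ffun x : supp => cond_mean f (agree_off u (val x))].

Lemma heat_bath_linear u : linear (heat_bath_fun u).
Proof.
move=> a f g; apply/ffunP => x; rewrite !ffunE /cond_mean /GRing.scale /=.
rewrite mulrA -mulrDl mulr_sumr -big_split /=; congr (_ / _).
by apply: eq_bigr => y _; rewrite !ffunE mulrDr /GRing.scale /= mulrCA.
Qed.
HB.instance Definition _ u :=
  GRing.isSemilinear.Build R L2 L2 _ (heat_bath_fun u)
    (GRing.semilinear_linear (heat_bath_linear u)).

Definition heat_bath (u : option 'I_d) : 'End(L2) := linfun (heat_bath_fun u).

Definition laplacian (u : option 'I_d) : 'End(L2) := \1%VF - heat_bath u.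

Definition laplacian_leaves : 'End(L2) := \sum_(i < d) laplacian (Some i).

Definition K0 : {vspace L2} := (lker laplacian_leaves :&: one_perp)%VS.

Definition K1 : {vspace L2} := (lker (laplacian_leaves - \1%VF) :&: one_perp)%VS.

(* For nu >= 0, [inner] is positive definite on [L2], so this is the orthogonal projection
   onto [W]: the projection onto [W] along its orthogonal complement. *)
Definition oproj (W : {vspace L2}) : 'End(L2) :=
  daddv_pi W (orthov (inner : {symmetric L2}) W).

(* The block proj_W T|_V : V -> W. *)
Definition block (W V : {vspace L2}) (T : 'End(L2)) :
    'Hom(subvs_of V, subvs_of W) :=
  (linfun (@vsproj _ _ W) \o oproj W \o T \o linfun (@vsval _ _ V))%VF.

Definition opnorm (V W : {vspace L2}) (T : 'Hom(subvs_of V, subvs_of W)) : R :=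
  sup [set L2norm (vsval (T f)) | f in [set f | L2norm (vsval f) <= 1]]%classic.

End Star.

(* Main.v *)
Require Import Defs.
From mathcomp Require Import all_boot all_order all_algebra.
From mathcomp Require Import classical_sets reals.
From mathcomp Require Import ring lra.
Import Order.TTheory GRing.Theory Num.Theory.
Local Open Scope ring_scope.

(** The operator [laplacian_leaves] is a sum of commuting orthogonal projections, so a mean
    zero [f] splits orthogonally as [f0 + f1 + f2] along [K0], [K1], [K2], and its energy is
    at least [|f1|^2 + 2 |f2|^2].  As [P = heat_bath nu None] is an orthogonal projection, the
    claim reduces to [P <= c D] with [c = (1 + eta) / 2] and [D = diag(1, 2, 3)]; by duality
    this means [<g, D^-1 g> <= c |g|^2] for all [g = P g], which follows from
    [|g0|^2 <= eta |g1|^2 + |g2|^2 / 3].  For the latter, put [u = P g0]: then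
    [|g0|^2 = <g, u>] and [<g0, u0> = |u|^2], and [|u0| <= r |g0|] forces
    [|u2|^2 <= r (1 - r) |g0|^2], while [|u1| <= s |g0|] with [s^2 = eta (1 - r) (1 - 4 r)];
    Young's inequality concludes. *)

(** * Eigenspaces of a sum of commuting projections *)

Definition eigenspace_of {R : fieldType} {V : vectType R} (T : 'End(V)) (k : nat) :
  {vspace V} := lker (T - k%:R *: \1%VF).

Lemma eigenspace_ofP {R : fieldType} {V : vectType R} (T : 'End(V)) k v :
  reflect (T v = k%:R *: v) (v \in eigenspace_of T k).
Proof.
rewrite memv_ker add_lfunE opp_lfunE scale_lfunE id_lfunE subr_eq0.
exact: eqP.
Qed.

Lemma memv_sumv_sup {R : fieldType} {V : vectType R} {I : finType}
    {U : I -> {vspace V}} i v : v \in U i -> v \in (\sum_j U j)%VS.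
Proof. by apply/subvP; apply: sumv_sup. Qed.

(** Induction on the number of projections: [Q ord0] commutes with the sum [L] of the others, so it
    preserves each eigenspace of [L]. There, a vector splits into a part killed by [Q ord0], whose
    eigenvalue stays [k], and a part fixed by it, whose eigenvalue becomes [k + 1]. *)
Lemma commuting_projections_decomp {R : fieldType} {V : vectType R} (n : nat)
    (Q : 'I_n -> 'End(V)) :
  (forall i v, Q i (Q i v) = Q i v) ->
  (forall i j v, Q i (Q j v) = Q j (Q i v)) ->
  forall v, v \in (\sum_(k < n.+1) eigenspace_of (\sum_i Q i)%R k)%VS.
Proof.
elim: n Q => [|n IH] Q QQ QC v.
  apply: (memv_sumv_sup ord0).
  by apply/eigenspace_ofP; rewrite big_ord0 lfunE /= scale0r.
have /memv_sumP[vs vsE ->] := IH (fun i => Q (lift ord0 i))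
  (fun i => QQ _) (fun i j => QC _ _) v.
set L := \sum_(i < n) _ in vsE *.
have -> : (\sum_i Q i)%R = Q ord0 + L by rewrite big_ord_recl.
set q := Q ord0.
have qL w : q (L w) = L (q w).
  rewrite /L !sum_lfunE linear_sum; apply: eq_bigr => i _; exact: QC.
apply: memv_suml => k _; have /eigenspace_ofP Lv := vsE k (erefl _).
have -> : vs k = (vs k - q (vs k)) + q (vs k) by rewrite subrK.
apply: memvD.
  apply: (memv_sumv_sup (widen_ord (leqnSn _) k)).
  apply/eigenspace_ofP; rewrite /= !lfunE /= !linearB /= -qL Lv QQ subrr add0r.
  by rewrite linearZ.
apply: (memv_sumv_sup (lift ord0 k)).
apply/eigenspace_ofP; rewrite !lfunE /= -qL Lv QQ linearZ /=.
by rewrite -{1}(scale1r (q _)) -scalerDl /bump /= natrD.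
Qed.

(** * Product form of [nu] and commutation of the leaf heat baths *)

Section Kernel.
Context {R : realType} {d q : nat} {nu : config d q -> R}.
Implicit Types (f g h : L2 nu) (x y : config d q) (i j : 'I_d).

(** Extension by zero, so that [f] can be evaluated after changing a leaf spin, which may leave the
    support. *)
Definition ext f x : R := if insub x is Some s then f s else 0.

Lemma ext_val f (s : supp nu) : ext f (val s) = f s.
Proof. by rewrite /ext valK. Qed.

Lemma sum_supp (A : pred (config d q)) (F : config d q -> R) :
  \sum_(s : supp nu | A (val s)) nu (val s) * F (val s)
  = \sum_(x | A x) nu x * F x.
Proof.
rewrite [RHS](bigID (fun x => nu x != 0)) /= [X in _ + X]big1 ?addr0; last first.
  by move=> x /andP[_ /negPn/eqP ->]; rewrite mul0r.
rewrite (eq_bigl (fun x => (x \in [pred x | nu x != 0]) && A x)); last first.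
  by move=> x; rewrite andbC.
by rewrite (big_sub_cond [pred x | nu x != 0] A).
Qed.

Definition update x i (b : 'I_q) : config d q :=
  [ffun w => if w == Some i then b else x w].

Lemma update_center x i b : update x i b None = x None.
Proof. by rewrite ffunE. Qed.

Lemma updateC x i j b c : i != j ->
  update (update x i b) j c = update (update x j c) i b.
Proof.
move=> ij; apply/ffunP => w; rewrite !ffunE.
case: eqP => [->|//]; rewrite ifN //.
by apply: contra ij => /eqP[->].
Qed.

Lemma sum_agree_off_leaf x i (F : config d q -> R) :
  \sum_(y | agree_off (Some i) x y) F y = \sum_b F (update x i b).
Proof.
rewrite (reindex_onto (update x i) (fun y => y (Some i))) /=.
  apply: eq_bigl => b; rewrite ffunE eqxx eqxx andbT.
  by apply/forallP => w; apply/implyP => wi; rewrite ffunE (negbTE wi).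
move=> y /forallP xy; apply/ffunP => w; rewrite ffunE.
by case: eqP => [->//|/eqP wi]; move: (xy w); rewrite wi => /eqP.
Qed.

Definition leaf_weight i (a b : 'I_q) : R :=
  condPr nu [set x : config d q | x (Some i) == b] [set x : config d q | x None == a].

Hypothesis hnu : is_distr nu.
Hypothesis hindep : leaves_cond_indep nu.

Definition center_weight (a : 'I_q) : R := Pr nu [set x : config d q | x None == a].

(** Conditional independence for the singletons [S i = [set x (Some i)]]: together with the centre
    spin they single out [x]. A centre spin of mass 0 is treated apart, since nonnegativity then
    forces [nu x = 0]. *)
Lemma nu_prod x :
  nu x = center_weight (x None) * \prod_i leaf_weight i (x None) (x (Some i)).
Proof.
set a := x None; have [C0|C0] := eqVneq (center_weight a) 0.
  rewrite C0 mul0r; apply/eqP; move/eqP: C0.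
  rewrite psumr_eq0 => [/allP/(_ x)|y _]; last by case: hnu.
  by rewrite mem_index_enum inE eqxx => /(_ isT).
have := @hindep a (fun i => [set x (Some i)]) C0; rewrite /condPr.
have -> : [set y : config d q | [forall i, y (Some i) \in [set x (Some i)]]] :&:
    [set y : config d q | y None == a] = [set x].
  apply/setP => y; rewrite !inE; apply/andP/eqP => [[/forallP yx /eqP ya]|->].
    by apply/ffunP => -[i|]; [move: (yx i); rewrite inE => /eqP|].
  by split=> //; apply/forallP => i; rewrite inE.
rewrite {1}/Pr big_set1 => nuE.
rewrite -[LHS](divfK C0) mulrC [_ / _]nuE; congr (_ * _).
apply: eq_bigr => i _; rewrite /leaf_weight /condPr.
by congr (Pr _ (_ :&: _) / _); apply/setP => y; rewrite !inE.
Qed.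

Lemma sum_leaf_weight i a : center_weight a != 0 -> \sum_b leaf_weight i a b = 1.
Proof.
move=> C0; rewrite /leaf_weight /condPr -mulr_suml -/(center_weight a).
rewrite -[RHS](divff C0); congr (_ / _).
rewrite [RHS]/center_weight /Pr (partition_big (fun x => x (Some i)) predT) //=.
by apply: eq_bigr => b _; apply: eq_bigl => x; rewrite !inE andbC.
Qed.

(** The constant [c] gathers the factors not involving leaf [i]; being the same for all [b], it
    cancels in the quotient defining the conditional mean. *)
Lemma nu_update x i : exists2 c, forall b, nu (update x i b) = c * leaf_weight i (x None) b
  & nu x = c * leaf_weight i (x None) (x (Some i)).
Proof.
exists (center_weight (x None) * \prod_(k | k != i) leaf_weight k (x None) (x (Some k))).
  move=> b; rewrite nu_prod (bigD1 i) //= update_center ffunE eqxx [leaf_weight _ _ _ * _]mulrC.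
  rewrite mulrA; congr (_ * _ * _); apply: eq_bigr => k ki.
  by rewrite ffunE ifN //; apply: contra ki => /eqP[->].
by rewrite nu_prod (bigD1 i) //= [leaf_weight _ _ _ * _]mulrC mulrA.
Qed.

Lemma center_weight_neq0 x : nu x != 0 -> center_weight (x None) != 0.
Proof. by rewrite nu_prod mulf_eq0 negb_or => /andP[]. Qed.

Lemma heat_bath_leafE i f (s : supp nu) :
  heat_bath_fun (Some i) f s
  = \sum_b leaf_weight i (val s None) b * ext f (update (val s) i b).
Proof.
set x := val s; have x0 : nu x != 0 := valP s.
rewrite ffunE /cond_mean -/x.
rewrite (eq_bigr (fun s => nu (val s) * ext f (val s))) => [|t _]; last first.
  by rewrite ext_val.
rewrite [X in _ / X](eq_bigr (fun s : supp nu => nu (val s) * 1)) => [|t _]; last first.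
  by rewrite mulr1.
rewrite (sum_supp (agree_off (Some i) x) (ext f)).
rewrite (sum_supp (agree_off (Some i) x) (fun=> 1)) !sum_agree_off_leaf.
have [c cE cx] := nu_update x i.
have c0 : c != 0 by apply: contraNneq x0 => c0; rewrite cx c0 mul0r.
under eq_bigr do rewrite cE -mulrA.
under [X in _ / X]eq_bigr do rewrite cE mulr1.
rewrite -!mulr_sumr sum_leaf_weight ?center_weight_neq0 // mulr1.
by rewrite mulrC mulKf.
Qed.

(** The resampling weights depend only on the centre spin, which leaf updates leave unchanged. Hence
    either order yields the same double sum with product weights. *)
Lemma heat_bath_leaf_comm i j f :
  heat_bath_fun (Some i) (heat_bath_fun (Some j) f)
  = heat_bath_fun (Some j) (heat_bath_fun (Some i) f).
Proof.
have [->//|ij] := eqVneq i j; apply/ffunP => s; rewrite !heat_bath_leafE.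
have main k l : \sum_b leaf_weight k (val s None) b
      * ext (heat_bath_fun (Some l) f) (update (val s) k b)
    = \sum_b \sum_c leaf_weight k (val s None) b * leaf_weight l (val s None) c
      * ext f (update (update (val s) k b) l c).
  (* A spin of weight 0 takes the configuration out of the support, where [heat_bath_leafE] does not
     apply; both sides are then 0. *)
  apply: eq_bigr => b _; have [->|w0] := eqVneq (leaf_weight k (val s None) b) 0.
    by rewrite mul0r big1 // => c _; rewrite !mul0r.
  have [c cE cx] := nu_update (val s) k.
  have sb : nu (update (val s) k b) != 0.
    rewrite cE mulf_neq0 //; apply: contraNneq (valP s) => c0.
    by rewrite cx c0 mul0r.
  pose t : supp nu := exist (fun x => nu x != 0) _ sb.
  rewrite -[update (val s) k b]/(val t) ext_val heat_bath_leafE.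
  rewrite [val t]/= update_center mulr_sumr.
  by apply: eq_bigr => c' _; rewrite mulrA.
rewrite !main exchange_big /=; apply: eq_bigr => c _; apply: eq_bigr => b _.
by rewrite updateC // [leaf_weight i _ _ * _]mulrC.
Qed.

End Kernel.

(** * The inner product, and heat baths as orthogonal projections *)

Section InnerProduct.
Context {R : realType} {d q : nat} {nu : config d q -> R}.
Hypothesis hnu : is_distr nu.
Implicit Types (f g h : L2 nu) (u : option 'I_d).

Lemma innerC f g : inner f g = inner g f.
Proof. by rewrite inner_sym expr0 mul1r. Qed.

Lemma innerDr f g h : inner f (g + h) = inner f g + inner f h.
Proof. exact: linearDr. Qed.

Lemma innerDl f g h : inner (f + g) h = inner f h + inner g h.
Proof. exact: linearDl. Qed.

Lemma innerZr a f g : inner f (a *: g) = a * inner f g.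
Proof. exact: linearZr. Qed.

Lemma innerZl a f g : inner (a *: f) g = a * inner f g.
Proof. exact: linearZl. Qed.

Lemma innerBr f g h : inner f (g - h) = inner f g - inner f h.
Proof. exact: linearBr. Qed.

Lemma innerBl f g h : inner (f - g) h = inner f h - inner g h.
Proof. exact: linearBl. Qed.

Lemma inner_sumr (I : finType) (P : pred I) f (F : I -> L2 nu) :
  inner f (\sum_(i | P i) F i) = \sum_(i | P i) inner f (F i).
Proof. exact: linear_sumr. Qed.

Lemma inner_suml (I : finType) (P : pred I) (F : I -> L2 nu) f :
  inner (\sum_(i | P i) F i) f = \sum_(i | P i) inner (F i) f.
Proof. by rewrite innerC inner_sumr; apply: eq_bigr => i _; rewrite innerC. Qed.

Lemma inner_ge0 f : 0 <= inner f f.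
Proof.
apply: sumr_ge0 => x _; rewrite -mulrA -expr2 mulr_ge0 ?sqr_ge0 //.
by case: hnu.
Qed.

(** Definiteness holds because functions live on the support, where [nu] does not vanish. *)
Lemma inner_eq0 f : inner f f = 0 -> f = 0.
Proof.
move=> /eqP; rewrite psumr_eq0 => [/allP f0|x _]; last first.
  by rewrite -mulrA -expr2 mulr_ge0 ?sqr_ge0 //; case: hnu.
apply/ffunP => x; rewrite ffunE; have := f0 x (mem_index_enum x) => /=.
by rewrite -mulrA mulf_eq0 (negbTE (valP x)) /= mulf_eq0 orbb => /eqP.
Qed.

Lemma L2normK f : L2norm f ^+ 2 = inner f f.
Proof. by rewrite sqr_sqrtr // inner_ge0. Qed.

Lemma L2norm_ge0 f : 0 <= L2norm f.
Proof. exact: sqrtr_ge0. Qed.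

Lemma L2normZ a f : L2norm (a *: f) = `|a| * L2norm f.
Proof. by rewrite /L2norm innerZl innerZr mulrA -expr2 sqrtrM ?sqr_ge0 // sqrtr_sqr. Qed.

Lemma L2norm_eq0 f : L2norm f = 0 -> f = 0.
Proof. by move=> f0; apply: inner_eq0; rewrite -L2normK f0 expr0n. Qed.

Lemma inner_le_norm f g : inner f g <= L2norm f * L2norm g.
Proof.
have [g0|g0] := eqVneq (L2norm g) 0.
  by rewrite (L2norm_eq0 g g0) /inner big1 ?mulr_ge0 ?L2norm_ge0 // => x _; rewrite ffunE mulr0.
have [f0|f0] := eqVneq (L2norm f) 0.
  by rewrite (L2norm_eq0 f f0) /inner big1 ?mulr_ge0 ?L2norm_ge0 // => x _; rewrite ffunE mulr0 mul0r.
have := inner_ge0 (L2norm g *: f - L2norm f *: g).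
rewrite !(innerBl, innerBr, innerZl, innerZr) (innerC g f) -!L2normK.
have a0 : 0 < L2norm f by rewrite lt_def f0 L2norm_ge0.
have b0 : 0 < L2norm g by rewrite lt_def g0 L2norm_ge0.
move=> H; rewrite -subr_ge0 -(pmulr_rge0 _ (mulr_gt0 a0 b0)).
by nra.
Qed.

Lemma agree_off_sym u x y : agree_off (d:=d) (q:=q) u x y = agree_off u y x.
Proof. by apply: eq_forallb => w; rewrite [y w == _]eq_sym. Qed.

Lemma agree_off_refl u x : agree_off (d:=d) (q:=q) u x x.
Proof. by apply/forallP => w; rewrite eqxx implybT. Qed.

Lemma agree_off_eq u x y : agree_off (d:=d) (q:=q) u x y ->
  agree_off u x =1 agree_off u y.
Proof.
move=> /forallP xy z; apply: eq_forallb => w.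
by move: (xy w); case: (w != u) => //= /eqP ->.
Qed.

Lemma class_mass_gt0 u (x : supp nu) :
  0 < \sum_(y : supp nu | agree_off u (val x) (val y)) nu (val y).
Proof.
have [nu0 _] := hnu; rewrite (bigD1 x) ?agree_off_refl //=.
apply: ltr_wpDr; first by apply: sumr_ge0 => y _; exact: nu0.
by rewrite lt_def nu0 (valP x).
Qed.

Lemma heat_bath_funB u f g :
  heat_bath_fun u (f - g) = heat_bath_fun u f - heat_bath_fun u g.
Proof. exact: linearB. Qed.

Lemma heat_bath_fun_proj u f : heat_bath_fun u (heat_bath_fun u f) = heat_bath_fun u f.
Proof.
apply/ffunP => x; rewrite ffunE {1}/cond_mean.
rewrite (eq_bigr (fun y : supp nu => nu (val y) * heat_bath_fun u f x)); last first.
  move=> y xy; rewrite !ffunE /cond_mean; congr (_ * (_ / _));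
  by apply: eq_bigl => z; rewrite (agree_off_eq _ _ _ xy).
by rewrite -mulr_suml mulrAC divff ?mul1r // gt_eqF // class_mass_gt0.
Qed.

(** The form is a sum over pairs [x], [y] agreeing off [u], with kernel [nu x * nu y / Z]; the class
    mass [Z] is common to both, so the kernel is symmetric. *)
Lemma heat_bath_fun_sym u f g :
  inner f (heat_bath_fun u g) = inner (heat_bath_fun u f) g.
Proof.
pose Z x := \sum_(y : supp nu | agree_off u x (val y)) nu (val y).
have main f1 g1 : inner f1 (heat_bath_fun u g1) =
    \sum_x \sum_(y : supp nu | agree_off u (val x) (val y))
      nu (val x) * f1 x * (nu (val y) * g1 y) / Z (val x).
  apply: eq_bigr => x _; rewrite ffunE /cond_mean mulrA mulr_sumr.
  by rewrite mulr_suml.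
rewrite (innerC (heat_bath_fun u f)) !main.
rewrite (exchange_big_dep predT) //=; apply: eq_bigr => y _.
rewrite (eq_bigl _ _ (fun x => agree_off_sym u (val x) (val y))).
apply: eq_bigr => x yx; rewrite [_ * (nu (val x) * _)]mulrC; congr (_ / _).
by apply: eq_bigl => z; rewrite (agree_off_eq _ _ _ yx).
Qed.

Definition const1 : L2 nu := [ffun=> 1].

Lemma meanE f : mean f = inner const1 f.
Proof. by apply: eq_bigr => x _; rewrite ffunE mulr1. Qed.

Lemma heat_bath_fun_one u : heat_bath_fun u const1 = const1.
Proof.
apply/ffunP => x; rewrite !ffunE /cond_mean.
rewrite (eq_bigr (fun y : supp nu => nu (val y))) => [|y _]; last by rewrite ffunE mulr1.
by rewrite divff // gt_eqF // class_mass_gt0.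
Qed.

End InnerProduct.

(** * Scalar inequalities between norms of components *)

(* [G, a, b] are the norms of [g0, g1, g2] and [x, y, z] those of [u0, u1, u2], where
   [u = P g0]. *)
Lemma K0_part_bound {R : realFieldType} (r s eta G x y z a b : R) :
  0 <= r -> 4 * r < 1 -> 0 <= eta -> s ^+ 2 = eta * ((1 - r) * (1 - 4 * r)) ->
  0 <= a -> 0 <= G -> x ^+ 2 + y ^+ 2 + z ^+ 2 <= G * x -> x <= r * G -> y <= s * G ->
  G ^+ 2 <= G * x + a * y + b * z ->
  G ^+ 2 <= eta * a ^+ 2 + b ^+ 2 / 3.
Proof.
move=> r0 r4 eta0 sE a0 G0 p xr ys H.
have zB : z ^+ 2 <= r * (1 - r) * G ^+ 2.
  (* Both factors are nonnegative as [x <= r * G <= (1 - r) * G]; expanding bounds [G * x - x ^+ 2],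
     which dominates [z ^+ 2]. *)
  have : 0 <= (r * G - x) * ((1 - r) * G - x) by apply: mulr_ge0; nra.
  by nra.
(* Young's inequality with weight [1 - 4 * r], which cancels against the same factor of [s ^+ 2]. *)
have ay : 2 * (a * y) <= (1 - 4 * r) * G ^+ 2 + eta * (1 - r) * a ^+ 2.
  have h1 : a * y <= a * (s * G) by apply: ler_wpM2l.
  have h2 := sqr_ge0 ((1 - 4 * r) * G - s * a).
  rewrite -(ler_pM2l (_ : 0 < 1 - 4 * r)); last by lra.
  have h3 : (s * a) ^+ 2 = eta * (1 - r) * a ^+ 2 * (1 - 4 * r) by rewrite exprMn sE; ring.
  have h4 : (1 - 4 * r) * (a * y) <= (1 - 4 * r) * (a * (s * G)) by apply: ler_wpM2l => //; lra.
  by nra.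
have bz : 2 * (b * z) <= (1 - r) * b ^+ 2 / 3 + 3 * r * G ^+ 2.
  have h2 := sqr_ge0 ((1 - r) * b - 3 * z).
  rewrite -(ler_pM2l (_ : 0 < 1 - r)); last by lra.
  by nra.
have Gx : G * x <= r * G ^+ 2 by nra.
(* After doubling the hypothesis, the coefficients of [G ^+ 2] on the right add up to
   [2r + (1 - 4r) + 3r = 1 + r], which leaves [1 - r] on the left. *)
rewrite -(ler_pM2l (_ : 0 < 1 - r)); last by lra.
by nra.
Qed.

(** Here [Fi] and [Gi] stand for the norms of the components of [f] and of [g = P f]. Young's
    inequality with weights 1, 2, 3 splits each [Fi * Gi], and the [G] terms are absorbed by the
    left side. *)
Lemma weighted_young {R : realFieldType} (eta F0 F1 F2 G0 G1 G2 : R) :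
  0 <= eta < 1 -> G0 ^+ 2 <= eta * G1 ^+ 2 + G2 ^+ 2 / 3 ->
  G0 ^+ 2 + G1 ^+ 2 + G2 ^+ 2 <= F0 * G0 + F1 * G1 + F2 * G2 ->
  G0 ^+ 2 + G1 ^+ 2 + G2 ^+ 2
  <= (1 + eta) / 2 * (F0 ^+ 2 + 2 * F1 ^+ 2 + 3 * F2 ^+ 2).
Proof.
move=> /andP[eta0 eta1] H N; set c := (1 + eta) / 2.
have c0 : 0 < c by rewrite /c; lra.
(* Using [(1 - eta) / 2] times [H], the surplus is [eta ^+ 2 / 2 * G1 ^+ 2 + 2 * eta / 3 * G2 ^+
   2]. *)
have D : G0 ^+ 2 + G1 ^+ 2 / 2 + G2 ^+ 2 / 3 <= c * (G0 ^+ 2 + G1 ^+ 2 + G2 ^+ 2).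
  have h : 0 <= (1 - eta) * (eta * G1 ^+ 2 + G2 ^+ 2 / 3 - G0 ^+ 2) by apply: mulr_ge0; lra.
  have h1 : 0 <= eta ^+ 2 * G1 ^+ 2 by rewrite mulr_ge0 ?sqr_ge0.
  have h2 : 0 <= eta * G2 ^+ 2 by rewrite mulr_ge0 ?sqr_ge0.
  by rewrite /c; nra.
have y0 := sqr_ge0 (c * F0 - G0).
have y1 := sqr_ge0 (2 * c * F1 - G1).
have y2 := sqr_ge0 (3 * c * F2 - G2).
rewrite -(ler_pM2l c0).
have N' := ler_wpM2l (ltW c0) N.
by nra.
Qed.

(** * Spectral splitting of mean-zero functions and the blocks of the centre heat bath *)

Section Spectral.
Context {R : realType} {d q : nat} {nu : config d q -> R}.
Hypothesis hnu : is_distr nu.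
Hypothesis hindep : leaves_cond_indep nu.
Implicit Types (f g h : L2 nu) (u : option 'I_d).
Local Notation L := (laplacian_leaves nu).

Lemma laplacianE u f : laplacian nu u f = f - heat_bath_fun u f.
Proof. by rewrite /laplacian add_lfunE opp_lfunE id_lfunE /heat_bath lfunE. Qed.

Lemma laplacian_proj u f : laplacian nu u (laplacian nu u f) = laplacian nu u f.
Proof.
rewrite !laplacianE heat_bath_funB heat_bath_fun_proj //.
by rewrite subrr subr0.
Qed.

Lemma laplacian_leaf_comm i j f :
  laplacian nu (Some i) (laplacian nu (Some j) f)
  = laplacian nu (Some j) (laplacian nu (Some i) f).
Proof.
have swap (V : zmodType) (a b c e : V) : a - b - (c - e) = a - c - (b - e).
  by rewrite !opprB addrACA [RHS]addrACA [- b - c]addrC.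
rewrite 4!laplacianE (heat_bath_funB (Some i)) (heat_bath_funB (Some j)).
rewrite swap.
by congr (_ - (_ - _)); exact: (heat_bath_leaf_comm hnu hindep i j f).
Qed.

Lemma laplacian_leaves_sym f g : inner f (L g) = inner (L f) g.
Proof.
rewrite /laplacian_leaves !sum_lfunE.
rewrite inner_sumr inner_suml.
apply: eq_bigr => i _.
by rewrite !laplacianE innerBr innerBl heat_bath_fun_sym.
Qed.

Lemma laplacian_leaves_one : L (const1 (nu:=nu)) = 0.
Proof.
rewrite /laplacian_leaves sum_lfunE big1 // => i _.
by rewrite laplacianE heat_bath_fun_one // subrr.
Qed.

Lemma eigenspace_ortho j k f g :
  f \in eigenspace_of L j -> g \in eigenspace_of L k -> j != k -> inner f g = 0.
Proof.
move=> /eigenspace_ofP Lf /eigenspace_ofP Lg jk; apply/eqP.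
have := laplacian_leaves_sym f g; rewrite Lf Lg innerZr innerZl => /eqP.
by rewrite -subr_eq0 -mulrBl mulf_eq0 subr_eq0 eqr_nat eq_sym (negbTE jk).
Qed.

Lemma one_eigen : const1 (nu:=nu) \in eigenspace_of L 0.
Proof. by apply/eigenspace_ofP; rewrite laplacian_leaves_one scale0r. Qed.

(** Its elements have mean zero, being orthogonal to [const1], which has eigenvalue 0. *)
Definition K2 : {vspace L2 nu} := (\sum_(k < d.+1 | (1 < k)%N) eigenspace_of L k)%VS.

Lemma mem_one_perp f : (f \in one_perp nu) = (mean f == 0).
Proof. by rewrite memv_ker lfunE. Qed.

Lemma K0P f : reflect (f \in eigenspace_of L 0 /\ mean f = 0) (f \in K0 nu).
Proof.
rewrite memv_cap [X in _ && X]mem_one_perp.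
apply: (iffP andP) => [[Lf /eqP mf]|[/eigenspace_ofP Lf ->]].
  by split=> //; apply/eigenspace_ofP; move: Lf; rewrite memv_ker scale0r => /eqP.
by rewrite memv_ker Lf scale0r !eqxx.
Qed.

Lemma K1P f : reflect (f \in eigenspace_of L 1) (f \in K1 nu).
Proof.
have -> : (f \in K1 nu) = (f \in eigenspace_of L 1) && (mean f == 0).
  rewrite -mem_one_perp /K1.
  rewrite /eigenspace_of.
  rewrite [1%:R *: _]scale1r.
  exact: memv_cap.
apply: (iffP andP) => [[Lf _]|Lf]; first exact: Lf.
split; first exact: Lf.
by rewrite meanE (eigenspace_ortho 0 1 _ _ one_eigen Lf isT) eqxx.
Qed.

Lemma K2_ortho j f g : (j < 2)%N -> f \in eigenspace_of L j -> g \in K2 -> inner f g = 0.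
Proof.
move=> j2 Lf /memv_sumP[gs gsE ->]; rewrite inner_sumr big1 // => k k1.
apply: eigenspace_ortho Lf (gsE _ k1) _.
by rewrite neq_ltn (leq_trans j2 k1).
Qed.

Lemma K0_K1_ortho f g : f \in K0 nu -> g \in K1 nu -> inner f g = 0.
Proof. by move=> /K0P[Lf _] /K1P Lg; exact: (eigenspace_ortho 0 1 _ _ Lf Lg isT). Qed.

Lemma K0_K2_ortho f g : f \in K0 nu -> g \in K2 -> inner f g = 0.
Proof. by move=> /K0P[Lf _] gK; exact: (K2_ortho 0 _ _ isT Lf gK). Qed.

Lemma K1_K2_ortho f g : f \in K1 nu -> g \in K2 -> inner f g = 0.
Proof. by move=> /K1P Lf gK; exact: (K2_ortho 1 _ _ isT Lf gK). Qed.

Lemma K2_energy f : f \in K2 -> 2 * inner f f <= inner f (L f).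
Proof.
move=> /memv_sumP[fs fsE ->]; set f2 := \sum_(k < _ | _) _.
have ortho (k : 'I_d.+1) : (1 < k)%N -> inner f2 (fs k) = inner (fs k) (fs k).
  move=> k1; rewrite /f2 (bigD1 k) //= innerDl inner_suml /=.
  rewrite big1 ?addr0 // => j /andP[j1 jk].
  exact: (eigenspace_ortho j k _ _ (fsE j j1) (fsE k k1) jk).
rewrite {2 4}/f2 linear_sum /= !inner_sumr mulr_sumr.
apply: ler_sum => k k1; have /eigenspace_ofP -> := fsE k k1.
rewrite innerZr ortho //; apply: ler_wpM2r; first exact: inner_ge0.
by rewrite ler_nat.
Qed.

Lemma one_perp_split f : mean f = 0 ->
  exists f0 f1 f2, [/\ f0 \in K0 nu, f1 \in K1 nu, f2 \in K2 & f = f0 + f1 + f2].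
Proof.
move=> f0; have /memv_sumP[fs fsE fE] : f \in (\sum_(k < d.+1) eigenspace_of L k)%VS.
  exact: (commuting_projections_decomp d (fun i => laplacian nu (Some i))
    (fun i => laplacian_proj (Some i)) laplacian_leaf_comm f).
(* A filtered sum stands in for [fs j]: for [d = 0] the index 1 does not exist in ['I_d.+1], and the
   sum is empty. *)
have part (j : nat) : \sum_(k < d.+1 | k == j :> nat) fs k \in eigenspace_of L j.
  by apply: memv_suml => k /eqP <-; exact: fsE.
pose f1 := \sum_(k < d.+1 | k == 1%N :> nat) fs k.
pose f2 := \sum_(k < d.+1 | (1 < k)%N) fs k.
have f1K : f1 \in K1 nu by apply/K1P; exact: part.
have f2K : f2 \in K2 by apply: memv_sumr => k _; exact: fsE.
have E : f = \sum_(k < d.+1 | k == 0%N :> nat) fs k + f1 + f2.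
  rewrite fE (bigID (fun k : 'I_d.+1 => k == 0%N :> nat)) /= -addrA; congr (_ + _).
  rewrite (bigID (fun k : 'I_d.+1 => k == 1%N :> nat)) /=; congr (_ + _);
  by apply: eq_bigl => -[[|[|k]] ?].
exists (\sum_(k < d.+1 | k == 0%N :> nat) fs k), f1, f2; split=> //.
apply/K0P; split; first exact: part.
move: f0; rewrite E !linearD /= [mean f1]meanE [mean f2]meanE.
rewrite (eigenspace_ortho 0 1 _ _ one_eigen (part 1%N) isT).
by rewrite (K2_ortho 0 _ _ isT one_eigen f2K) !addr0.
Qed.

Lemma inner_split f0 f1 f2 g0 g1 g2 :
  f0 \in K0 nu -> f1 \in K1 nu -> f2 \in K2 -> g0 \in K0 nu -> g1 \in K1 nu -> g2 \in K2 ->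
  inner (f0 + f1 + f2) (g0 + g1 + g2) = inner f0 g0 + inner f1 g1 + inner f2 g2.
Proof.
move=> f0K f1K f2K g0K g1K g2K; rewrite !(innerDl, innerDr).
rewrite (innerC f1 g0) (innerC f2 g0) (innerC f2 g1).
rewrite (K0_K1_ortho _ _ f0K g1K) (K0_K1_ortho _ _ g0K f1K).
rewrite (K0_K2_ortho _ _ f0K g2K) (K0_K2_ortho _ _ g0K f2K).
by rewrite (K1_K2_ortho _ _ f1K g2K) (K1_K2_ortho _ _ g1K f2K) !add0r !addr0.
Qed.

Lemma laplacian_leaves_energy f0 f1 f2 :
  f0 \in K0 nu -> f1 \in K1 nu -> f2 \in K2 ->
  inner f1 f1 + 2 * inner f2 f2 <= inner (f0 + f1 + f2) (L (f0 + f1 + f2)).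
Proof.
move=> f0K f1K f2K; rewrite laplacian_leaves_sym !linearD /=.
have /K0P[/eigenspace_ofP -> _] := f0K; have /K1P/eigenspace_ofP -> := f1K.
rewrite scale0r scale1r add0r innerDl -laplacian_leaves_sym.
rewrite !innerDr (innerC f1 f0) (K0_K1_ortho _ _ f0K f1K).
rewrite (K1_K2_ortho _ _ f1K f2K) add0r addr0.
have -> : inner f2 (L (f0 + f1 + f2)) = inner f2 (L f2).
  rewrite !linearD /=; have /K0P[/eigenspace_ofP -> _] := f0K.
  have /K1P/eigenspace_ofP -> := f1K.
  by rewrite scale0r scale1r add0r innerDr (innerC f2 f1) (K1_K2_ortho _ _ f1K f2K) add0r.
by rewrite lerD2l K2_energy.
Qed.

Lemma oproj_split (W : {vspace L2 nu}) w z :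
  w \in W -> {in W, forall v, inner z v = 0} -> oproj W (w + z) = w.
Proof.
move=> wW zW; pose V := orthov (inner (nu:=nu) : {symmetric L2 nu}) W.
have capWV : (W :&: V = 0)%VS.
  apply/eqP; rewrite -subv0; apply/subvP => v; rewrite memv_cap memv0 => /andP[vW].
  by move=> /mem_orthovP/(_ v vW)/(inner_eq0 hnu)->.
have zV : z \in V by apply/mem_orthovP.
rewrite /oproj -/V linearD /= daddv_pi_id //.
(* The components of [z] in [W] and [V] add up to [z], and the one in [V] is already [z], so the one
   in [W] vanishes. *)
have := daddv_pi_add capWV (subvP (addvSr W V) _ zV).
by rewrite (@daddv_pi_id _ _ V W) 1?capvC // => /eqP; rewrite eq_sym -subr_eq subrr eq_sym
  => /eqP ->; rewrite addr0.
Qed.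

(** The contraction hypothesis bounds the set by 1, so that [sup] is a true supremum and not the
    default value 0; the inequality then follows by normalizing [f]. *)
Lemma opnorm_bound (V W : {vspace L2 nu}) (T : 'Hom(subvs_of V, subvs_of W)) :
  (forall f : subvs_of V, L2norm (vsval (T f)) <= L2norm (vsval f)) ->
  0 <= opnorm T /\ forall f : subvs_of V, L2norm (vsval (T f)) <= opnorm T * L2norm (vsval f).
Proof.
move=> Tc; rewrite /opnorm.
set A := [set L2norm (vsval (T f)) | f in [set f | L2norm (vsval f) <= 1]]%classic.
have ubA : has_ubound A.
  by exists 1 => _ [f /= f1 <-]; exact: le_trans (Tc f) f1.
split.
  apply: ub_le_sup => //; exists 0 => /=.
    by rewrite -(scale0r 0) L2normZ normr0 mul0r ler01.
  by rewrite linear0 -(scale0r 0) L2normZ normr0 mul0r.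
move=> f; have [f0|f0] := eqVneq (L2norm (vsval f)) 0.
  by rewrite f0 mulr0 -f0.
have fp : 0 < L2norm (vsval f) by rewrite lt_def f0 L2norm_ge0.
rewrite -ler_pdivrMr //; apply: ub_le_sup => //.
exists ((L2norm (vsval f))^-1 *: f).
  by rewrite /= L2normZ ger0_norm ?invr_ge0 ?L2norm_ge0 // mulVf.
by rewrite /= linearZ /= L2normZ ger0_norm ?invr_ge0 ?L2norm_ge0 // mulrC.
Qed.

(** For the projection [P], the square of the norm of [P f] is [<f, P f>]; Cauchy-Schwarz gives the
    bound after cancelling one factor. *)
Lemma heat_bath_norm u f : L2norm (heat_bath_fun u f) <= L2norm f.
Proof.
have [->|P0] := eqVneq (L2norm (heat_bath_fun u f)) 0; first exact: L2norm_ge0.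
rewrite -(ler_pM2r (_ : 0 < L2norm (heat_bath_fun u f))); last first.
  by rewrite lt_def P0 L2norm_ge0.
rewrite -expr2 L2normK // -heat_bath_fun_sym // heat_bath_fun_proj //.
exact: inner_le_norm.
Qed.

Lemma mean_heat_bath u f : mean (heat_bath_fun u f) = mean f.
Proof. by rewrite !meanE heat_bath_fun_sym // heat_bath_fun_one. Qed.

Lemma block_split (W V : {vspace L2 nu}) u (f : subvs_of V) w z :
  heat_bath_fun u (vsval f) = w + z -> w \in W -> {in W, forall v, inner z v = 0} ->
  vsval (block W V (heat_bath nu u) f) = w.
Proof.
move=> E wW zW; rewrite /block !comp_lfunE [linfun _ f]lfunE /= [heat_bath _ _ _]lfunE /= E.
by rewrite oproj_split // lfunE /= vsprojK.
Qed.

(** Turns the two block norms into bounds on the components of [P f]. The blocks are contractions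
    because [P] is one and the splitting is orthogonal, so [opnorm_bound] applies. *)
Lemma heat_bath_K0_split (r := opnorm (block (K0 nu) (K0 nu) (heat_bath nu None)))
    (s := opnorm (block (K1 nu) (K0 nu) (heat_bath nu None))) :
  [/\ 0 <= r, 0 <= s & forall f, f \in K0 nu -> exists u0 u1 u2 : L2 nu,
    [/\ [/\ u0 \in K0 nu, u1 \in K1 nu & u2 \in K2],
        heat_bath_fun None f = u0 + u1 + u2,
        L2norm u0 <= r * L2norm f & L2norm u1 <= s * L2norm f]].
Proof.
have split (f : subvs_of (K0 nu)) : exists u0 u1 u2 : L2 nu,
    [/\ [/\ u0 \in K0 nu, u1 \in K1 nu & u2 \in K2],
        heat_bath_fun None (vsval f) = u0 + u1 + u2,
        vsval (block (K0 nu) (K0 nu) (heat_bath nu None) f) = u0 &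
        vsval (block (K1 nu) (K0 nu) (heat_bath nu None) f) = u1].
  have /K0P[_ mf] := subvsP f.
  have [|u0 [u1 [u2 [u0K u1K u2K E]]]] := one_perp_split (heat_bath_fun None (vsval f)).
    by rewrite mean_heat_bath.
  exists u0, u1, u2; split=> //.
    apply: (block_split _ _ None f u0 (u1 + u2)) => [|//|v vK]; first by rewrite E addrA.
    by rewrite innerC innerDr (K0_K1_ortho _ _ vK u1K) (K0_K2_ortho _ _ vK u2K) addr0.
  apply: (block_split _ _ None f u1 (u0 + u2)) => [|//|v vK].
    by rewrite E addrA (addrC u1).
  rewrite innerDl (K0_K1_ortho _ _ u0K vK) innerC.
  by rewrite (K1_K2_ortho _ _ vK u2K) addr0.
have norms (u0 u1 u2 : L2 nu) : u0 \in K0 nu -> u1 \in K1 nu -> u2 \in K2 ->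
    L2norm u0 <= L2norm (u0 + u1 + u2) /\ L2norm u1 <= L2norm (u0 + u1 + u2).
  move=> u0K u1K u2K; have i0 := inner_ge0 hnu u0; have i1 := inner_ge0 hnu u1.
  have i2 := inner_ge0 hnu u2.
  by rewrite /L2norm inner_split //; split; apply: ler_wsqrtr; lra.
have [|r0 rB] := opnorm_bound _ _ (block (K0 nu) (K0 nu) (heat_bath nu None)).
  move=> f; have [u0 [u1 [u2 [[u0K u1K u2K] E -> _]]]] := split f.
  apply: le_trans (heat_bath_norm None (vsval f)); rewrite E.
  by have [] := norms u0 u1 u2 u0K u1K u2K.
have [|s0 sB] := opnorm_bound _ _ (block (K1 nu) (K0 nu) (heat_bath nu None)).
  move=> f; have [u0 [u1 [u2 [[u0K u1K u2K] E _ ->]]]] := split f.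
  apply: le_trans (heat_bath_norm None (vsval f)); rewrite E.
  by have [] := norms u0 u1 u2 u0K u1K u2K.
split; [exact: r0|exact: s0|move=> f fK].
have fE : vsval (vsproj (K0 nu) f) = f by rewrite vsprojK.
have [u0 [u1 [u2 [uK E E0 E1]]]] := split (vsproj (K0 nu) f).
exists u0, u1, u2; split=> //; first by rewrite -fE.
  by have := rB (vsproj (K0 nu) f); rewrite E0 fE.
by have := sB (vsproj (K0 nu) f); rewrite E1 fE.
Qed.

End Spectral.

(** * Assembly of the spectral and scalar estimates *)

Theorem theorem25 (R : realType) (d q : nat) (hq : (1 <= q)%N)
    (nu : config d q -> R) (hnu : is_distr nu)
    (hindep : leaves_cond_indep nu) :
  let r := opnorm (block (K0 nu) (K0 nu) (heat_bath nu None)) in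
  let eta := opnorm (block (K1 nu) (K0 nu) (heat_bath nu None)) ^+ 2
               / ((1 - r) * (1 - 4 * r)) in
  r < 1 / 5 -> eta < 1 ->
  forall f : L2 nu, mean f = 0 ->
    (1 - eta) / 2 * inner f f
    <= inner f ((laplacian nu None
                 + ((1 + eta) / 2) *: laplacian_leaves nu) f).
Proof.
move=> r; set s := opnorm (block (K1 nu) _ _); move=> eta r5 eta1 f mf.
have [r0 s0 Psplit] := heat_bath_K0_split hnu hindep; rewrite -/r -/s in r0 s0 Psplit.
have d0 : 0 < (1 - r) * (1 - 4 * r) by apply: mulr_gt0; lra.
have sE : s ^+ 2 = eta * ((1 - r) * (1 - 4 * r)) by rewrite /eta divfK // gt_eqF.
have eta0 : 0 <= eta by apply: divr_ge0; [exact: sqr_ge0|exact: ltW].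
have [f0 [f1 [f2 [f0K f1K f2K fE]]]] := one_perp_split hnu hindep f mf.
pose g := heat_bath_fun None f.
have gP : heat_bath_fun None g = g by exact: heat_bath_fun_proj.
have [|g0 [g1 [g2 [g0K g1K g2K gE]]]] := one_perp_split hnu hindep g.
  by rewrite mean_heat_bath.
have [u0 [u1 [u2 [[u0K u1K u2K] uE u0B u1B]]]] := Psplit g0 g0K.
have H0 : L2norm g0 ^+ 2 <= eta * L2norm g1 ^+ 2 + L2norm g2 ^+ 2 / 3.
  (* With [u = P g0], orthogonality and the projection property give
     [<g0, u0> = <g0, P g0> = <u, u>]. *)
  have g0u0 : inner g0 u0 = L2norm u0 ^+ 2 + L2norm u1 ^+ 2 + L2norm u2 ^+ 2.
    rewrite !L2normK // -(inner_split hnu) // -uE -heat_bath_fun_sym // heat_bath_fun_proj // uE.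
    rewrite !innerDr (K0_K1_ortho hnu _ _ g0K u1K) (K0_K2_ortho _ _ g0K u2K).
    by rewrite !addr0.
  (* As [g = P g], one has [<g0, g0> = <g0, P g> = <P g0, g> = <u, g>]. *)
  have gu : inner g0 g0 = inner g0 u0 + inner g1 u1 + inner g2 u2.
    rewrite -(inner_split hnu) // -gE -uE heat_bath_fun_sym gP gE.
    rewrite !innerDl (innerC g1) (innerC g2) (K0_K1_ortho hnu _ _ g0K g1K).
    by rewrite (K0_K2_ortho _ _ g0K g2K) !addr0.
  have c0 := inner_le_norm hnu g0 u0; have c1 := inner_le_norm hnu g1 u1.
  have c2 := inner_le_norm hnu g2 u2; have r4 : 4 * r < 1 by lra.
  have E1 := c0; rewrite g0u0 in E1.
  have E2 : L2norm g0 ^+ 2 <= L2norm g0 * L2norm u0 + L2norm g1 * L2norm u1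
      + L2norm g2 * L2norm u2 by rewrite (L2normK hnu) gu !lerD.
  exact: (K0_part_bound r s eta _ _ _ _ _ _ r0 r4 eta0 sE (L2norm_ge0 g1) (L2norm_ge0 g0)
    E1 u0B u1B E2).
have gg : inner f g = L2norm g0 ^+ 2 + L2norm g1 ^+ 2 + L2norm g2 ^+ 2.
  by rewrite !L2normK // -(inner_split hnu) // -gE -[RHS](heat_bath_fun_sym None f g) gP.
have fg : inner f g = inner f0 g0 + inner f1 g1 + inner f2 g2.
  by rewrite -(inner_split hnu) // -fE -gE.
have ff : inner f f = L2norm f0 ^+ 2 + L2norm f1 ^+ 2 + L2norm f2 ^+ 2.
  by rewrite !L2normK // -(inner_split hnu) // -fE.
have energy := laplacian_leaves_energy hnu f0 f1 f2 f0K f1K f2K.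
rewrite -fE -!(L2normK hnu) in energy.
have c0 := inner_le_norm hnu f0 g0; have c1 := inner_le_norm hnu f1 g1.
have c2 := inner_le_norm hnu f2 g2.
have eta01 : 0 <= eta < 1 by rewrite eta0.
have N : L2norm g0 ^+ 2 + L2norm g1 ^+ 2 + L2norm g2 ^+ 2
    <= L2norm f0 * L2norm g0 + L2norm f1 * L2norm g1 + L2norm f2 * L2norm g2.
  by rewrite -gg fg !lerD.
have Y := weighted_young eta (L2norm f0) (L2norm f1) (L2norm f2) _ _ _ eta01 H0 N.
(* Since [<f, P f> = <g, g>] and [1 - (1 - eta) / 2 = (1 + eta) / 2], the goal bounds [<g, g>] by
   [(1 + eta) / 2] times [<f, f>] plus the leaf energy. Weights 1, 1, 1 from the former and 0, 1, 2
   from [energy] add to the 1, 2, 3 of [Y]. *)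
rewrite add_lfunE scale_lfunE innerDr innerZr laplacianE innerBr -/g.
have e2 : 0 < (1 + eta) / 2 by lra.
have := ler_wpM2l (ltW e2) energy.
by rewrite ff gg; nra.
Qed.
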